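(* Fix $\theta\in(0,\tfrac23)$ and $\gamma\ge0$, and consider the continuous boosting game with $N$ samples lasting $T$ rounds, where $\delta\in[0,1)$ is determined by $\gamma=\delta^2T/2$. In the following, $O(\cdot)$ is understood as $T\to\infty$ with $\gamma,\theta$ fixed, with implied constants depending only on $\gamma$ and $\theta$. (a) Let $\tau=T^\theta$, and for $t=-T,\dots,-1$ put $s_{t,i}=\sum_{r=-T}^{t-1}\bigl(y_ih_r(\mathbf x_i)-\delta\bigr)$. If in each round $t$ the player uses a distribution $\mathbf p_t$ such that, whenever at least one $i$ has $s_{t,i}>-\delta T$, $p_{t,i}$ is proportional to $w_{t,i}$, where $$w_{t,i}=\begin{cases}0,& s_{t,i}\le-\delta T,\\ -f'(s_{t,i},t+1-\tau),& s_{t,i}>-\delta T,\end{cases}$$ and $\mathbf p_t$ is an arbitrary probability vector if $s_{t,i}\le-\delta T$ for all $i$, then for any choices of the adversary the training error satisfies $$\frac1N\sum_{i=1}^N\mathbf 1_{\{\sum_{t=-T}^{-1}y_ih_t(\mathbf x_i)\le0\}}\le\frac{2}{\sqrt\pi}\int_{\sqrt\gamma}^\infty e^{-x^2}\,dx+O(T^{-\theta/2}).$$ (b) If the number of samples satisfies $N\ge T^{(\theta+2)/4}$, then for any player strategy (the final hypothesis being the majority vote of the weak hypotheses) there exists an adversary strategy such that the training error satisfies $$\frac1N\sum_{i=1}^N\mathbf 1_{\{\sum_{t=-T}^{-1}y_ih_t(\mathbf x_i)\le0\}}\ge\frac{2}{\sqrt\pi}\int_{\sqrt\gamma}^\infty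 e^{-x^2}\,dx-O(T^{-\theta/4}).$$
   Context: Continuous boosting game. Training examples $(\mathbf x_i,y_i)$, $i=1,\dots,N$, are given, with $\mathbf x_i\in\mathcal X$ distinct and labels $y_i\in\{-1,1\}$. The game lasts $T$ rounds, $t=-T,\dots,-1$. In round $t$ the player announces a probability vector $\mathbf p_t=(p_{t,1},\dots,p_{t,N})$ on the examples; then the adversary, knowing $\mathbf p_t$, returns a weak hypothesis $h_t:\mathcal X\to[-1,1]$, which may be any such function subject to $$\sum_{i:\,y_ih_t(\mathbf x_i)>0}p_{t,i}|h_t(\mathbf x_i)|-\sum_{j:\,y_jh_t(\mathbf x_j)\le0}p_{t,j}|h_t(\mathbf x_j)|\ge\delta,$$ i.e. $\sum_i p_{t,i}\,y_ih_t(\mathbf x_i)\ge\delta$ (this is what ''edge $\delta/2$'' means). The player's final hypothesis is the majority vote of the $h_t$, with training error $\frac1N\sum_{i=1}^N\mathbf 1_{\{\sum_{t=-T}^{-1}y_ih_t(\mathbf x_i)\le0\}}$. A player strategy chooses $\mathbf p_t$ from the history of play; an adversary strategy chooses $h_t$ from the history and $\mathbf p_t$. For $t<0$ the function $f$ is $$f(s,t)=\begin{cases}\frac{2}{\sqrt\pi}\int_{(s+\delta T)/\sqrt{-2t}}^\infty e^{-x^2}\,dx,& s>-\delta T,\\ 1,& s\le-\delta T,\end{cases}$$ and $f'$ denotes its derivative in $s$ (used only for $s>-\delta T$). *)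

(* Defs.v *)
From HB Require Import structures.
From mathcomp Require Import all_boot all_order all_algebra.
From mathcomp Require Import all_classical all_reals all_analysis.
Set Implicit Arguments.
Unset Strict Implicit.
Unset Printing Implicit Defensive.
Import Order.TTheory GRing.Theory Num.Theory.
Import numFieldNormedType.Exports.
Local Open Scope classical_set_scope.
Local Open Scope ring_scope.

Definition gauss_tail (R : realType) (a : R) : R :=
  2 / Num.sqrt pi *
  \int[@lebesgue_measure R]_(x in `[a, +oo[) expR (- x ^+ 2).

(* Only meaningful for t < 0. *)
Definition potential (R : realType) (delta : R) (T : nat) (s t : R) : R :=
  if - (delta * T%:R) < s
  then gauss_tail ((s + delta * T%:R) / Num.sqrt (- (2 * t)))
  else 1.

Section Game.
Variables (R : realType) (N : nat) (X : Type).

(* A round consists of the player's weights and the weak hypothesis with which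
   the adversary answers. A history lists the rounds in chronological order;
   if it has size k, then the next round to be played is t = k - T. *)
Definition round : Type := (('I_N -> R) * (X -> R))%type.
Definition history : Type := seq round.

Definition is_prob (p : 'I_N -> R) : Prop :=
  (forall i, 0 <= p i) /\ \sum_i p i = 1.

Definition is_weak_hypothesis (delta : R) (x : 'I_N -> X) (y : 'I_N -> R)
    (p : 'I_N -> R) (h : X -> R) : Prop :=
  (forall z, -1 <= h z <= 1) /\
  delta <= \sum_(i | 0 < y i * h (x i)) p i * `|h (x i)|
           - \sum_(j | y j * h (x j) <= 0) p j * `|h (x j)|.

Definition player_strategy (sigma : history -> 'I_N -> R) : Prop :=
  forall H, is_prob (sigma H).

Definition adversary_strategy (delta : R) (x : 'I_N -> X) (y : 'I_N -> R)
    (alpha : history -> ('I_N -> R) -> X -> R) : Prop :=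
  forall H p, is_prob p -> is_weak_hypothesis delta x y p (alpha H p).

Fixpoint play (sigma : history -> 'I_N -> R)
    (alpha : history -> ('I_N -> R) -> X -> R) (k : nat) : history :=
  if k is k'.+1 then
    let H := play sigma alpha k' in
    rcons H (sigma H, alpha H (sigma H))
  else [::].

Definition training_error (x : 'I_N -> X) (y : 'I_N -> R) (H : history) : R :=
  N%:R^-1 * \sum_i (\sum_(r <- H) y i * r.2 (x i) <= 0)%R%:R.

Definition chip_position (delta : R) (x : 'I_N -> X) (y : 'I_N -> R)
    (H : history) (i : 'I_N) : R :=
  \sum_(r <- H) (y i * r.2 (x i) - delta).

Definition boosting_weight (delta theta : R) (T : nat) (x : 'I_N -> X)
    (y : 'I_N -> R) (H : history) (i : 'I_N) : R :=
  let s := chip_position delta x y H i in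
  let t := (size H)%:R - T%:R in
  let tau := T%:R `^ theta in
  if s <= - (delta * T%:R) then 0
  else - derive1 (fun u : R => potential delta T u (t + 1 - tau)) s.

Definition obeys_boosting_rule (delta theta : R) (T : nat) (x : 'I_N -> X)
    (y : 'I_N -> R) (H : history) (p : 'I_N -> R) : Prop :=
  (exists i, - (delta * T%:R) < chip_position delta x y H i) ->
  exists c : R, forall i, p i = c * boosting_weight delta theta T x y H i.

End Game.

(* Main.v *)
Require Import Defs.
From HB Require Import structures.
From mathcomp Require Import all_boot all_order all_algebra.
From mathcomp Require Import all_classical all_reals all_analysis.
From mathcomp Require Import measurable_realfun ring lra.
Set Implicit Arguments.
Unset Strict Implicit.
Unset Printing Implicit Defensive.
Import Order.TTheory GRing.Theory Num.Theory.
Import numFieldNormedType.Exports.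
Local Open Scope classical_set_scope.
Local Open Scope ring_scope.

(* Put [a = s + delta T] and let [v] be the remaining time plus an offset. The
   function [u(a, v) = gauss_tail (a / sqrt (2 v))] solves the heat equation
   [u_v = u_aa / 2] and is convex in [a >= 0], so in one round a live chip that
   moves by [d] changes it by [u_a d + u_aa (d ^ 2 - 1) / 2 + O(v ^ (- 3 / 2))].
   For the player's weights the first-order terms sum to at most [0], and
   [d ^ 2 - 1 <= 3 delta]. The errors telescope to [O(1 / sqrt tau)] for the
   offset [tau] at the end of the game.

   The adversary keeps dead chips fixed and moves the live ones to a vertex of
   the polytope [{b in [-1, 1] ^ N | sum p (b - delta) = sum w (b - delta) = 0}].
   There all but two chips have [b = 1] or [b = - 1], while the first-order terms
   cancel. The adversary's potential is shifted by [A = T ^ (1 / 2 - theta / 4)]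
   and uses [tau = T ^ (theta / 2)]: then chips still alive at the end contribute
   at most [gauss_tail (A / sqrt (2 tau)) = O(sqrt tau / A)], a chip dies with
   potential at most [1], and the shift costs [O(A / sqrt T)] at the start. *)

(** * The Gaussian tail *)

Definition gauss_coef (R : realType) : R := 2 / Num.sqrt pi.

Lemma gauss_coef_gt0 (R : realType) : 0 < gauss_coef R.
Proof. by rewrite divr_gt0// sqrtr_gt0 pi_gt0. Qed.

Lemma integrable_gauss_fun (R : realType) (D : set R) : measurable D ->
  (@lebesgue_measure R).-integrable D (EFin \o gauss_fun).
Proof.
by move=> mD; apply: integrableS integrableT_gauss.
Qed.

(** With [z] as the upper limit of an integral from [-oo], the fundamental theorem of calculus
    applies and gives the derivative. *)
Lemma gauss_tailE (R : realType) (z : R) :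
  gauss_tail z = gauss_coef R * (\int[lebesgue_measure]_x (@gauss_fun R x)
    - \int[lebesgue_measure]_(x in `]-oo, z]) gauss_fun x).
Proof.
congr (_ * _).
rewrite -[RHS](_ : \int[lebesgue_measure]_(x in `]z, +oo[) gauss_fun x = _).
  rewrite Rintegral_itv_obnd_cbnd//.
  exact: integrable_gauss_fun.
rewrite -(@Rintegral_itvB _ _ -oo%O)// ?set_itvNyy//.
exact: integrable_gauss_fun.
Qed.

Lemma is_derive_gauss_tail (R : realType) (z : R) :
  is_derive z 1 (@gauss_tail R) (- (gauss_coef R * gauss_fun z)).
Proof.
rewrite (funext (@gauss_tailE R)).
pose F (z : R) := \int[lebesgue_measure]_(x in `]-oo, z]) gauss_fun x.
have [dF F'] : derivable F z 1 /\ F^`()%classic z = gauss_fun z.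
  apply: (@continuous_FTC1 _ _ _ _ (z + 1)); rewrite ?ltrDl//.
    exact: integrable_gauss_fun.
  by rewrite ltNyr.
  exact: continuous_gauss_fun.
have /= HF : is_derive z 1 F (gauss_fun z).
  by rewrite derive1E in F'; exact: DeriveDef dF F'.
have HB := is_deriveB (is_derive_cst (\int[lebesgue_measure]_x (@gauss_fun R x) : R^o) z 1) HF.
have HZ := is_deriveZ (gauss_coef R) HB.
rewrite sub0r [_ *: _]mulrN in HZ.
exact: HZ.
Qed.

Lemma gauss_tail0 (R : realType) : gauss_tail (0 : R) = 1.
Proof.
rewrite /gauss_tail /Rintegral integral0y_gauss /= mulrA divfK ?divff//.
by rewrite gt_eqF// sqrtr_gt0 pi_gt0.
Qed.

Lemma gauss_tail_ge0 (R : realType) (z : R) : 0 <= gauss_tail z.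
Proof.
apply: mulr_ge0; first exact/ltW/gauss_coef_gt0.
by apply: Rintegral_ge0 => //= x _; apply: expR_ge0.
Qed.

Lemma is_derive_gauss_fun (R : realType) (x : R) :
  is_derive x 1 (@gauss_fun R) (- (2 * x * gauss_fun x)).
Proof.
have H := is_deriveN (is_deriveM (is_derive_id x 1) (is_derive_id x 1)).
have -> : @gauss_fun R = expR \o (- (id * id)).
  by apply/funext => t; rewrite /gauss_fun expr2.
have := @is_derive1_comp _ expR _ x _ _ (is_derive_expR _) H.
by rewrite /= /GRing.scale/= !mulr1 -mulr2n mulrN -[x *+ 2]mulr_natl [expR _ * _]mulrC.
Qed.

(** On [[z, +oo[] the factor [x / z] is at least [1], and [x * gauss_fun x] has the antiderivative
    [- gauss_fun x / 2]. This bounds the final potential of the chips that the adversary leaves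
    alive. *)
Lemma gauss_tail_le_inv (R : realType) (z : R) : 0 < z ->
  gauss_tail z <= gauss_coef R / z.
Proof.
move=> z0; rewrite ler_pM2l ?gauss_coef_gt0//.
have HF (x : R) : is_derive x 1 (fun x => - gauss_fun x / 2) (x * gauss_fun x).
  have := is_deriveM (is_deriveN (is_derive_gauss_fun x))
    (is_derive_cst (2^-1 : R^o) x 1).
  by rewrite scaler0 add0r opprK /GRing.scale/= -mulrA mulKf.
have H : (\int[lebesgue_measure]_(x in `[z, +oo[) (x * gauss_fun x)%:E =
    0%:E - (- gauss_fun z / 2)%:E)%E.
  apply: (@ge0_continuous_FTC2y _ _ (fun x => - gauss_fun x / 2)).
  - by move=> x zx; rewrite mulr_ge0 ?gauss_fun_ge0// (le_trans (ltW z0)).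
  - apply: continuous_subspaceT => x; apply: cvgM; first exact: cvg_id.
    exact: continuous_gauss_fun.
  - rewrite -[0](mul0r 2^-1) -oppr0; apply: cvgM; last exact: cvg_cst.
    by apply: cvgN; exact: cvg_gauss_fun.
  - by move=> x _; apply: ex_derive.
  - apply: cvg_at_right_filter.
    apply: cvgM; last exact: cvg_cst.
    by apply: cvgN; exact: continuous_gauss_fun.
  - by move=> x _; rewrite derive1E; apply: derive_val.
rewrite -[z^-1]mulr1 ler_pdivlMl// -lee_fin EFinM fineK; last first.
  apply: integrable_fin_num => //.
  exact: integrable_gauss_fun.
rewrite -ge0_integralZl ?lee_fin ?(ltW z0)//; last first.
  by apply/measurable_EFinP/measurable_funTS; exact: measurable_gauss_fun.
apply: (@le_trans _ _ (\int[lebesgue_measure]_(x in `[z, +oo[) (x * gauss_fun x)%:E)%E).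
  apply: ge0_le_integral => //=.
  - by move=> x _; rewrite lee_fin mulr_ge0 ?gauss_fun_ge0// ltW.
  - apply/measurable_EFinP/measurable_funTS/measurable_funM => //.
    exact: measurable_gauss_fun.
  - apply/measurable_EFinP/measurable_funTS/measurable_funM => //.
    exact: measurable_gauss_fun.
  - move=> x; rewrite in_itv/= andbT => zx.
    by rewrite lee_fin ler_wpM2r ?gauss_fun_ge0.
rewrite H -EFinB lee_fin.
have := @gauss_fun_le1 _ z.
by have := @gauss_fun_ge0 _ z; lra.
Qed.

(** * Taylor bounds *)

(** The inequality [(x - a) * (x - b) <= 0] says that [x] lies between [a] and [b] in either order,
    so that the Taylor bounds cover moves in both directions. *)
Lemma between_trans (R : realFieldType) (a b x t : R) :
  (x - a) * (x - b) <= 0 -> (t - a) * (t - x) <= 0 -> (t - a) * (t - b) <= 0.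
Proof.
case: (ltgtP x a) => [xa|xa|->]; last 1 first.
- rewrite -expr2 => _ ta; suff /eqP-> : t - a == 0 by rewrite mul0r.
  by rewrite -sqrf_eq0 eq_le ta sqr_ge0.
- case: (ltgtP x b) => [xb|xb|->]; [nra| |by []].
  by have [ta|ta] := ltP a t; have [tx|tx] := ltP t x; nra.
- case: (ltgtP x b) => [xb|xb|->]; [|nra|by []].
  by have [ta|ta] := ltP t a; have [tx|tx] := ltP x t; nra.
Qed.

Lemma between_dist (R : realFieldType) (a b x : R) :
  (x - a) * (x - b) <= 0 -> `|x - a| <= `|b - a|.
Proof.
move=> xab.
have : `|x - a| ^+ 2 <= `|x - a| * `|b - a|.
  rewrite real_normK ?num_real// -normrM; apply: le_trans (ler_norm _).
  by rewrite -subr_le0; apply: le_trans xab; rewrite le_eqVlt; apply/orP; left; apply/eqP; ring.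
have := normr_ge0 (x - a); have := normr_ge0 (b - a).
move: `|x - a| `|b - a| => u w w0 u0 uw.
by rewrite leNgt; apply/negP => wu; nra.
Qed.

Lemma mean_value_bound (R : realType) (f df : R -> R) (a b M : R) :
  (forall x : R, is_derive x 1 f (df x)) ->
  (forall x, (x - a) * (x - b) <= 0 -> `|df x| <= M) ->
  `|f b - f a| <= M * `|b - a|.
Proof.
move=> fdf; wlog ab : a b / a <= b => [wl|] dfM.
  have [/wl->//|/ltW/wl] := leP a b.
  rewrite distrC [X in _ -> _ <= _ * X]distrC; apply => x xab; apply: dfM.
  by rewrite mulrC.
have cf : {within `[a, b], continuous f}.
  apply: continuous_subspaceT => x; apply: differentiable_continuous.
  exact/derivable1_diffP.
have [c] := MVT_segment ab (fun x _ => fdf x) cf.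
rewrite in_itv/= => /andP[ac cb] ->; rewrite normrM ler_wpM2r ?dfM//.
by nra.
Qed.

(** The mean value bound is applied twice: [f] minus its linear part at [a] has derivative
    [f1 x - f1 a], which [f2] controls. The sharp factor [1 / 2] is given up. *)
Lemma taylor1_bound (R : realType) (f f1 f2 : R -> R) (a b M : R) :
  (forall x : R, is_derive x 1 f (f1 x)) -> (forall x : R, is_derive x 1 f1 (f2 x)) ->
  (forall x, (x - a) * (x - b) <= 0 -> `|f2 x| <= M) ->
  `|f b - f a - f1 a * (b - a)| <= M * `|b - a| ^+ 2.
Proof.
move=> ff1 f1f2 f2M.
have M0 : 0 <= M by apply: le_trans (f2M a _); rewrite ?subrr ?mul0r.
pose g x := f x - f1 a * x.
have gg (x : R) : is_derive x 1 g (f1 x - f1 a).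
  have := is_deriveB (ff1 x) (is_deriveZ (f1 a) (is_derive_id x 1)).
  by rewrite /GRing.scale/= mulr1.
rewrite expr2 mulrA (_ : f b - _ - _ = g b - g a); last by rewrite /g; ring.
apply: (mean_value_bound gg) => x xab.
apply: (@le_trans _ _ (M * `|x - a|)).
  apply: (mean_value_bound f1f2) => t tax; apply: f2M.
  exact: between_trans xab tax.
by rewrite ler_wpM2l// (between_dist xab).
Qed.

Lemma taylor2_bound (R : realType) (f f1 f2 f3 : R -> R) (a b M : R) :
  (forall x : R, is_derive x 1 f (f1 x)) ->
  (forall x : R, is_derive x 1 f1 (f2 x)) ->
  (forall x : R, is_derive x 1 f2 (f3 x)) -> (forall x, `|f3 x| <= M) ->
  `|f b - f a - f1 a * (b - a) - f2 a / 2 * (b - a) ^+ 2| <=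
    M * `|b - a| ^+ 3.
Proof.
move=> ff1 f12 f23 f3M.
have M0 : 0 <= M by apply: le_trans (f3M a).
pose g x := f x - f1 a * x - f2 a / 2 * ((x - a) * (x - a)).
have gg (x : R) : is_derive x 1 g (f1 x - f1 a - f2 a * (x - a)).
  have Hx := is_deriveB (is_derive_id x 1) (is_derive_cst (a : R^o) x 1).
  have := is_deriveB (is_deriveB (ff1 x) (is_deriveZ (f1 a) (is_derive_id x 1)))
    (is_deriveZ (f2 a / 2) (is_deriveM Hx Hx)).
  rewrite /GRing.scale/= !mulr1 subr0 mulr1 => H.
  by apply: is_derive_eq H _; rewrite (_ : (id - cst a) x = x - a)//; field.
rewrite [`|_| ^+ 3]exprSr [M * (_ * _)]mulrA (_ : f b - _ - _ - _ = g b - g a); last first.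
  by rewrite /g; field.
apply: (mean_value_bound gg) => x xab.
apply: (@le_trans _ _ (M * `|x - a| ^+ 2)).
  by apply: (taylor1_bound f12 f23) => t _.
by rewrite ler_wpM2l// lerXn2r ?nnegrE// (between_dist xab).
Qed.

Opaque gauss_coef.

Lemma sqr_gauss_fun_bound (R : realType) (z : R) : (1 + z ^+ 2) * gauss_fun z <= 1.
Proof.
rewrite -ler_pdivlMr ?expR_gt0// div1r /gauss_fun expRN invrK.
exact: expR_ge1Dx.
Qed.

Lemma cube_gauss_fun_bound (R : realType) (z : R) : 0 <= z ->
  z ^+ 3 * gauss_fun z <= 1.
Proof.
move=> z0; rewrite -ler_pdivlMr ?expR_gt0// div1r /gauss_fun expRN invrK.
have -> : expR (z ^+ 2) = expR (z ^+ 2 / 2) ^+ 2.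
  by rewrite -expRM_natl; congr expR; field.
have h := expR_ge1Dx (z ^+ 2 / 2).
have h1 : (1 + z ^+ 2 / 2) ^+ 2 <= expR (z ^+ 2 / 2) ^+ 2.
  by rewrite lerXn2r// nnegrE ?expR_ge0// addr_ge0// divr_ge0// sqr_ge0.
apply: le_trans h1; rewrite -subr_ge0.
have -> : (1 + z ^+ 2 / 2) ^+ 2 - z ^+ 3 = 1 + (z * (1 - z / 2)) ^+ 2 by field.
by rewrite addr_ge0// sqr_ge0.
Qed.

(** This is the second derivative of [gauss_tail]; its sign for [z >= 0] is the convexity of the
    potential. *)
Definition gauss_curv (R : realType) (z : R) : R :=
  2 * gauss_coef R * z * gauss_fun z.

Lemma gauss_curv_bound (R : realType) (z : R) : 0 <= z ->
  0 <= gauss_curv z <= 2 * gauss_coef R.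
Proof.
move=> z0; have k0 := gauss_coef_gt0 R; have g0 := gauss_fun_ge0 z.
rewrite /gauss_curv -(mulrA _ z); have h := sqr_gauss_fun_bound z.
have k2 : 0 < 2 * gauss_coef R by rewrite mulr_gt0.
apply/andP; split; first by rewrite !mulr_ge0// ltW.
have h1 : z * gauss_fun z <= 1.
  by apply: le_trans h; rewrite ler_wpM2r//; nra.
by rewrite ler_piMr// ltW.
Qed.

Lemma is_derive_gauss_slope (R : realType) (z : R) :
  is_derive z 1 (fun z : R => - (gauss_coef R * gauss_fun z)) (gauss_curv z).
Proof.
have := is_deriveN (is_deriveZ (gauss_coef R) (is_derive_gauss_fun z)).
rewrite /GRing.scale/= => H; apply: is_derive_eq H _.
by rewrite /gauss_curv; ring.
Qed.

Lemma is_derive_gauss_curv (R : realType) (z : R) : is_derive z 1 (@gauss_curv R)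
  (2 * gauss_coef R * ((1 - 2 * z ^+ 2) * gauss_fun z)).
Proof.
have := is_deriveZ (2 * gauss_coef R)
  (is_deriveM (is_derive_id z 1) (is_derive_gauss_fun z)).
have -> : 2 * gauss_coef R \*: (id * @gauss_fun R) = @gauss_curv R.
  by apply/funext => x; rewrite /gauss_curv -[RHS]mulrA.
by rewrite /GRing.scale/= => H; apply: is_derive_eq H _; ring.
Qed.

(** The third derivative [2 c (1 - 2 z^2) exp (- z^2)], with [c = gauss_coef R], is at most [4 c] in
    absolute value, because [|1 - 2 z^2| <= 2 (1 + z^2)]. *)
Lemma gauss_tail_taylor (R : realType) (z h : R) :
  `|gauss_tail (z + h) - gauss_tail z + gauss_coef R * gauss_fun z * h
    - gauss_curv z / 2 * h ^+ 2| <= 4 * gauss_coef R * `|h| ^+ 3.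
Proof.
have k0 := gauss_coef_gt0 R.
have := @taylor2_bound _ _ _ _ _ z (z + h) (4 * gauss_coef R)
  (@is_derive_gauss_tail R) (@is_derive_gauss_slope R) (@is_derive_gauss_curv R).
rewrite (_ : z + h - z = h); last by ring.
rewrite mulNr opprK; apply => x.
have g0 := gauss_fun_ge0 x; have gb := sqr_gauss_fun_bound x.
have x2 := sqr_ge0 x.
rewrite normrM ger0_norm; last by nra.
rewrite (_ : 4 * gauss_coef R = 2 * gauss_coef R * 2); last by ring.
rewrite ler_wpM2l ?mulr_ge0 ?(ltW k0)// ler_norml; apply/andP; split; nra.
Qed.

(** The passage of time multiplies [z = a / sqrt (2 v)] by a factor [rho] close to [1]. The
    displacement [z (1 - rho)] is unbounded, yet the error is uniform in [z]: between [z rho] and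
    [z] the second derivative is [O(z^-2)], since [x^3 exp (- x^2)] is bounded and
    [z^2 <= 2 x^2]. *)
Lemma gauss_tail_contract (R : realType) (z rho : R) :
  0 <= z -> 0 <= rho <= 1 -> 1 <= 2 * rho ^+ 2 ->
  `|gauss_tail (z * rho) - gauss_tail z - gauss_coef R * gauss_fun z * z * (1 - rho)|
    <= 4 * gauss_coef R * (1 - rho) ^+ 2.
Proof.
move=> z0 /andP[rho0 rho1] rho2; have k0 := gauss_coef_gt0 R.
have [->|zN0] := eqVneq z 0.
  by rewrite !(mul0r, mulr0) !subrr normr0 mulr_ge0 ?sqr_ge0// mulr_ge0// ltW.
have {zN0}z_gt0 : 0 < z by rewrite lt_neqAle eq_sym zN0.
have := @taylor1_bound _ _ _ _ z (z * rho) (4 * gauss_coef R / z ^+ 2)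
  (@is_derive_gauss_tail R) (@is_derive_gauss_slope R).
have -> : z * rho - z = - (z * (1 - rho)) by ring.
rewrite mulrNN normrN real_normK ?num_real// exprMn [_ * (_ * (1 - rho))]mulrA.
rewrite [_ / _ * (_ * _)]mulrA divfK ?sqrf_eq0 ?gt_eqF//.
apply => x xz.
have /andP[x1 x2] : z * rho <= x <= z.
  apply/andP; split; rewrite leNgt; apply/negP => h.
    by have h' : x < z by [nra]; nra.
  by have h' : z * rho < x by [nra]; nra.
have x0 : 0 <= x by apply: le_trans x1; rewrite mulr_ge0.
have /andP[c0 _] := gauss_curv_bound x0.
rewrite ger0_norm// ler_pdivlMr ?exprn_gt0//.
have z2 : z ^+ 2 <= 2 * x ^+ 2.
  have : (z * rho) ^+ 2 <= x ^+ 2 by rewrite lerXn2r// nnegrE mulr_ge0.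
  by rewrite exprMn; have := sqr_ge0 z; nra.
apply: (le_trans (ler_wpM2l c0 z2)).
have := cube_gauss_fun_bound x0.
have -> : gauss_curv x * (2 * x ^+ 2) = 4 * gauss_coef R * (x ^+ 3 * gauss_fun x).
  by rewrite /gauss_curv; ring.
by nra.
Qed.

(** * Heat equation for the potential *)

(** A telescoping substitute for the size [v ^ (- 3 / 2)] of the error in one round. *)
Definition sqrt_gap (R : realType) (v : R) : R :=
  (Num.sqrt v)^-1 - (Num.sqrt (v + 1))^-1.

Lemma sqrt_gap_bound (R : realType) (v : R) : 1 <= v ->
  (v * Num.sqrt v)^-1 <= 4 * sqrt_gap v.
Proof.
move=> v1; rewrite /sqrt_gap.
set p := Num.sqrt v; set q := Num.sqrt (v + 1).
have p2 : p ^+ 2 = v by rewrite sqr_sqrtr//; lra.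
have q2 : q ^+ 2 = v + 1 by rewrite sqr_sqrtr//; lra.
have p1 : 1 <= p by rewrite -(sqrtr1 R) ler_wsqrtr.
have q0 : 0 < q by rewrite sqrtr_gt0; lra.
(* Since [q^2 - p^2 = 1], the gap is [1 / (p q (p + q))]; with [q <= 3 p / 2] the product
   [q (p + q)] stays below [4 p^2]. *)
have pq : q <= 3 / 2 * p.
  rewrite -(@ler_pXn2r _ 2) ?nnegrE ?(ltW q0)//; last by lra.
  by rewrite exprMn p2 q2 expr2; lra.
rewrite -subr_ge0.
have -> : 4 * (p^-1 - q^-1) - (v * p)^-1 =
    (4 * p ^+ 2 - q * (q + p)) / (p ^+ 3 * q * (q + p)).
  have Ep : (q - p) * (q + p) = 1.
    by rewrite (_ : _ * _ = q ^+ 2 - p ^+ 2); [rewrite p2 q2|]; ring.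
  have -> : p^-1 - q^-1 = ((q - p) * (q + p)) / (p * q * (q + p)).
    by field; apply/and3P; split; apply/lt0r_neq0; lra.
  rewrite Ep -p2; field.
  by apply/and3P; split; apply/lt0r_neq0; lra.
apply: divr_ge0; last first.
  by rewrite !mulr_ge0 ?exprn_ge0//; lra.
by nra.
Qed.

(** A move by [d] at fixed time and the passage of one unit of time at fixed [a] are expanded
    separately. By the heat equation their leading terms, with [d^2] and with [-1], share one
    coefficient. *)
Lemma gauss_tail_heat_step (R : realType) (a d v r : R) :
  1 <= v -> 0 <= a -> `|d| <= 2 -> r = Num.sqrt (2 * v) ->
  `|gauss_tail ((a + d) / r) - gauss_tail (a / Num.sqrt (2 * (v + 1)))
    + gauss_coef R * gauss_fun (a / r) / r * d
    - gauss_curv (a / r) * (d ^+ 2 - 1) / (4 * v)|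
  <= 84 * gauss_coef R * sqrt_gap v.
Proof.
move=> v1 a0 d2 rE.
have k0 := gauss_coef_gt0 R.
set p := Num.sqrt v; set q := Num.sqrt (v + 1).
have p2 : p ^+ 2 = v by rewrite sqr_sqrtr//; lra.
have q2 : q ^+ 2 = v + 1 by rewrite sqr_sqrtr//; lra.
have p1 : 1 <= p by rewrite -(sqrtr1 R) ler_wsqrtr.
have q0 : 0 < q by rewrite sqrtr_gt0; lra.
have p0 : 0 < p by lra.
have r0 : 0 < r by rewrite rE sqrtr_gt0; lra.
have r2 : r ^+ 2 = 2 * v by rewrite rE sqr_sqrtr//; lra.
have pr : p <= r by rewrite rE ler_wsqrtr//; lra.
have s0 : 0 < Num.sqrt (2 : R) by rewrite sqrtr_gt0.
set z := a / r; pose rho := p / q.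
have z0 : 0 <= z by rewrite divr_ge0// ltW.
have -> : a / Num.sqrt (2 * (v + 1)) = z * rho.
  rewrite /z /rho rE !sqrtrM// -/p -/q; field.
  by rewrite !gt_eqF.
have rho2 : rho ^+ 2 = v / (v + 1) by rewrite expr_div_n p2 q2.
have rho0 : 0 <= rho by rewrite divr_ge0// ltW.
have E : (1 - rho) * (1 + rho) = (v + 1)^-1.
  rewrite (_ : _ * _ = 1 - rho ^+ 2); last by ring.
  by rewrite rho2; field; apply/lt0r_neq0; lra.
have w0 : 0 < (v + 1)^-1 by rewrite invr_gt0; lra.
have wE : (v + 1)^-1 * (v + 1) = 1 by rewrite mulVf// lt0r_neq0//; lra.
have rho1 : rho <= 1.
  by rewrite -subr_ge0 -(@pmulr_lge0 _ (1 + rho)) ?E ?(ltW w0)//; lra.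
set e := 1 - rho in E *.
have e0 : 0 <= e by rewrite subr_ge0.
have ew : e <= (v + 1)^-1 by rewrite -E ler_peMr//; lra.
pose u := v^-1.
have u0 : 0 < u by rewrite invr_gt0; lra.
have uv : u * v = 1 by rewrite mulVf// lt0r_neq0//; lra.
have wu : (v + 1)^-1 <= u by rewrite lef_pV2 ?posrE//; lra.
have T1 := gauss_tail_taylor z (d / r).
have T2 : `|gauss_tail (z * rho) - gauss_tail z - gauss_coef R * gauss_fun z * z * e|
    <= 4 * gauss_coef R * e ^+ 2.
  apply: gauss_tail_contract => //; first by rewrite rho0.
  by rewrite rho2 -(ler_pM2r (_ : 0 < v + 1)) ?mulrA ?divfK ?lt0r_neq0//; lra.
have T3 : `|e - u / 2| <= u ^+ 2 / 2.
  have -> : e - u / 2 = e ^+ 2 / 2 - u * (v + 1)^-1 / 2.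
    have e_eq : e = (v + 1)^-1 / 2 + e ^+ 2 / 2.
      by rewrite -E /e; field.
    have w_eq : (v + 1)^-1 = u - u * (v + 1)^-1.
      by rewrite /u; field; apply/andP; split; apply/lt0r_neq0; lra.
    by lra.
  have e2 := sqr_ge0 e; have : e ^+ 2 <= u ^+ 2.
    by have := le_trans ew wu; nra.
  by rewrite ler_norml => eu; apply/andP; split; nra.
have /andP[zg0 zg1] : 0 <= gauss_fun z * z <= 1.
  have := sqr_gauss_fun_bound z; have := gauss_fun_ge0 z => g0 g1.
  by apply/andP; split; nra.
set D1 := gauss_tail (z + d / r) - gauss_tail z
  + gauss_coef R * gauss_fun z * (d / r) - gauss_curv z / 2 * (d / r) ^+ 2 in T1.
set D2 := gauss_tail (z * rho) - _ - _ in T2.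
have -> : (a + d) / r = z + d / r by rewrite mulrDl.
rewrite (_ : _ - _ = D1 - D2 - gauss_coef R * (gauss_fun z * z) * (e - u / 2)); last first.
  rewrite /D1 /D2 expr_div_n r2 /gauss_curv /u; field.
  by apply/andP; split; apply/lt0r_neq0; lra.
have pv : p <= v by rewrite -p2 expr2 ler_peMr// ltW.
pose t := (v * p)^-1.
have t0 : 0 <= t by rewrite invr_ge0 mulr_ge0//; lra.
have u2 : u ^+ 2 <= t.
  rewrite /t invfM expr2; apply: ler_wpM2l; first exact: ltW.
  by rewrite lef_pV2 ?posrE// (lt_le_trans p0).
have T1' : `|D1| <= 16 * gauss_coef R * t.
  apply: (le_trans T1).
  have : `|d / r| ^+ 3 <= 4 * t.
    rewrite normrM normfV (gtr0_norm r0) expr_div_n.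
    rewrite ler_pdivrMr ?exprn_gt0//.
    have d3 : `|d| ^+ 3 <= 8.
      rewrite (_ : 8 = 2 ^+ 3); last by ring.
      by rewrite lerXn2r// nnegrE.
    apply: (le_trans d3).
    have -> : 4 * t * r ^+ 3 = 8 * (r / p).
      by rewrite exprSr r2 /t; field; apply/andP; split; apply/lt0r_neq0; lra.
    by rewrite ler_peMr// ler_pdivlMr// mul1r.
  by move: (`|d / r| ^+ 3) => X XT; nra.
have T2' : `|D2| <= 4 * gauss_coef R * t.
  apply: (le_trans T2); rewrite ler_wpM2l ?mulr_ge0 ?(ltW k0)//.
  by apply: le_trans u2; have := le_trans ew wu; nra.
have T3' : `|gauss_coef R * (gauss_fun z * z) * (e - u / 2)| <= gauss_coef R * t.
  rewrite -mulrA normrM (gtr0_norm k0) ler_wpM2l ?(ltW k0)//.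
  rewrite normrM ger0_norm//.
  apply: le_trans (ler_wpM2l zg0 T3) _.
  by have u2' := sqr_ge0 u; nra.
(* [D1], [D2] and the correction of [e] contribute [16], [4] and [1] multiples of
   [gauss_coef R * t], and [t <= 4 * sqrt_gap v], hence [84]. *)
have tg := sqrt_gap_bound v1.
rewrite -/p -/t in tg.
apply: (le_trans (ler_normB _ _)).
have := ler_normB D1 D2.
by nra.
Qed.

(** * Change of the potential of a single chip in one round *)

Lemma gauss_tail_lipschitz (R : realType) (x y : R) :
  `|gauss_tail y - gauss_tail x| <= gauss_coef R * `|y - x|.
Proof.
apply: (mean_value_bound (@is_derive_gauss_tail R)) => t _.
have k0 := gauss_coef_gt0 R; have g0 := gauss_fun_ge0 t.
by rewrite normrN ger0_norm ?mulr_ge0 ?(ltW k0)// ler_piMr ?(ltW k0)// gauss_fun_le1.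
Qed.

Lemma gauss_tail_antitone (R : realType) (x y : R) :
  x <= y -> gauss_tail y <= gauss_tail x.
Proof.
move=> xy; have cf : {within `[x, y], continuous (@gauss_tail R)}.
  apply: continuous_subspaceT => t; apply: differentiable_continuous.
  by have := is_derive_gauss_tail t => ?; exact/derivable1_diffP.
have [c _ E] := MVT_segment xy (fun t _ => is_derive_gauss_tail t) cf.
rewrite -subr_le0 E mulNr oppr_le0.
by rewrite !mulr_ge0 ?gauss_fun_ge0 ?subr_ge0// ltW// gauss_coef_gt0.
Qed.

Lemma gauss_tail_le1 (R : realType) (x : R) : 0 <= x -> gauss_tail x <= 1.
Proof. by move=> x0; rewrite -(gauss_tail0 R) gauss_tail_antitone. Qed.

(* The shift [A] is [0] for the player and large for the adversary. *)
Definition chip_potential (R : realType) (A v a : R) : R :=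
  if 0 < a then gauss_tail ((a + A) / Num.sqrt (2 * v)) else 1.

(** Minus the derivative in [a] of [gauss_tail (a / sqrt (2 v))]; on live chips these are the
    unnormalised weights of the player. *)
Definition chip_weight (R : realType) (v a : R) : R :=
  gauss_coef R * gauss_fun (a / Num.sqrt (2 * v)) / Num.sqrt (2 * v).

Lemma chip_weight_gt0 (R : realType) (v a : R) : 0 < v -> 0 < chip_weight v a.
Proof.
move=> v0; apply: divr_gt0; last by rewrite sqrtr_gt0 mulr_gt0.
by apply: mulr_gt0; [exact: gauss_coef_gt0|exact: expR_gt0].
Qed.

Lemma chip_potential_le1 (R : realType) (A v a : R) :
  0 <= A -> chip_potential A v a <= 1.
Proof.
move=> A0; rewrite /chip_potential; case: ifP => // a0.
by rewrite gauss_tail_le1// divr_ge0 ?sqrtr_ge0// addr_ge0// ltW.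
Qed.

(** This brings terms of order [1 / v] into telescoping form: [delta / v], and the cost of the
    fractional chips. *)
Lemma ler_div_sqrt_gap (R : realType) (x y v : R) :
  1 <= v -> 0 <= y -> x * Num.sqrt v <= y -> x / v <= 4 * y * sqrt_gap v.
Proof.
move=> v1 y0 xy; have v0 : 0 < v by lra.
have s0 : 0 < Num.sqrt v by rewrite sqrtr_gt0.
have -> : x / v = (x * Num.sqrt v) * (v * Num.sqrt v)^-1.
  by field; rewrite !gt_eqF.
have := sqrt_gap_bound v1.
have t0 : 0 < (v * Num.sqrt v)^-1 by rewrite invr_gt0 mulr_gt0.
move: (v * _)^-1 t0 => t t0 tg.
apply: (le_trans (ler_wpM2r (ltW t0) xy)).
by rewrite (mulrC 4) -mulrA ler_wpM2l.
Qed.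

Lemma sqrt_gap_ge0 (R : realType) (v : R) : 1 <= v -> 0 <= sqrt_gap v.
Proof.
move=> v1; have := sqrt_gap_bound v1.
have : 0 <= (v * Num.sqrt v)^-1 by rewrite invr_ge0 mulr_ge0 ?sqrtr_ge0//; lra.
lra.
Qed.

(* A chip that crosses the boundary does no harm because [gauss_tail] is at
   least [1] on the negative half line. *)
Lemma chip_potential_step_le (R : realType) (G delta v a d : R) :
  1 <= v -> 0 <= delta <= 1 -> delta * Num.sqrt v <= G ->
  - 1 - delta <= d <= 1 - delta ->
  chip_potential 0 v (a + d) <= chip_potential 0 (v + 1) a
    - (if 0 < a then chip_weight v a * d else 0)
    + (84 + 6 * G) * gauss_coef R * sqrt_gap v.
Proof.
move=> v1 /andP[dl0 dl1] dG /andP[d0 d1].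
have k0 := gauss_coef_gt0 R; have g0 := sqrt_gap_ge0 v1.
have G0 : 0 <= G by apply: le_trans dG; rewrite mulr_ge0 ?sqrtr_ge0.
have K0 : 0 <= (84 + 6 * G) * gauss_coef R * sqrt_gap v.
  by rewrite !mulr_ge0 ?(ltW k0)//; lra.
have r0 : 0 < Num.sqrt (2 * v) by rewrite sqrtr_gt0; lra.
rewrite {2}/chip_potential; case: ifPn => [a0|_]; last first.
  by have := @chip_potential_le1 _ 0 v (a + d) (lexx _); lra.
rewrite addr0.
have h : chip_potential 0 v (a + d) <= gauss_tail ((a + d) / Num.sqrt (2 * v)).
  rewrite /chip_potential addr0; case: ifPn => // ad.
  rewrite -(gauss_tail0 R); apply: gauss_tail_antitone.
  by rewrite mulr_le0_ge0 ?invr_ge0 ?(ltW r0)// leNgt.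
have d2 : `|d| <= 2 by rewrite ler_norml; apply/andP; split; lra.
have := gauss_tail_heat_step v1 (ltW a0) d2 erefl.
rewrite ler_norml => /andP[_]; rewrite -/(chip_weight v a).
have /andP[c0 c1] := @gauss_curv_bound _ (a / Num.sqrt (2 * v))
  (divr_ge0 (ltW a0) (ltW r0)).
set c := gauss_curv _ in c0 c1 *.
have dg := ler_div_sqrt_gap v1 G0 dG.
have : c * (d ^+ 2 - 1) / (4 * v) <= 6 * G * gauss_coef R * sqrt_gap v.
  have -> : c * (d ^+ 2 - 1) / (4 * v) = c / 4 * ((d ^+ 2 - 1) / v).
    by field; rewrite gt_eqF//; lra.
  have dd : (d ^+ 2 - 1) / v <= 3 * (delta / v).
    rewrite mulrA ler_pM2r ?invr_gt0; last by lra.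
    by nra.
  have dv0 : 0 <= delta / v by rewrite divr_ge0//; lra.
  apply: (@le_trans _ _ (c / 4 * (3 * (delta / v)))).
    by rewrite ler_wpM2l//; lra.
  apply: (@le_trans _ _ (2 * gauss_coef R / 4 * (3 * (delta / v)))).
    by rewrite ler_wpM2r//; lra.
  by nra.
by lra.
Qed.

(* [m = 1] is allowed for every chip, and [m = 0] only for one whose margin
   [d + delta] is [1] or [-1]. *)
Lemma chip_potential_step_ge (R : realType) (A G delta v a d m : R) :
  1 <= v -> 2 <= A -> 0 <= delta <= 1 -> delta * Num.sqrt v <= G ->
  - 1 - delta <= d <= 1 - delta -> 0 <= m <= 1 ->
  (`|d + delta| = 1 \/ m = 1) -> 0 < a ->
  chip_potential A (v + 1) a - chip_weight v (a + A) * d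
    - (84 + 4 * G) * gauss_coef R * sqrt_gap v - m * (gauss_coef R / 2 / v)
  <= chip_potential A v (a + d).
Proof.
move=> v1 A2 /andP[dl0 dl1] dG /andP[d0 d1] /andP[m0 m1] dm a0.
have k0 := gauss_coef_gt0 R; have g0 := sqrt_gap_ge0 v1.
have G0 : 0 <= G by apply: le_trans dG; rewrite mulr_ge0 ?sqrtr_ge0.
have r0 : 0 < Num.sqrt (2 * v) by rewrite sqrtr_gt0; lra.
rewrite {1}/chip_potential a0.
(* [A >= 2] keeps [a + A + d] nonnegative, so for a chip that dies in this round the new potential
   [1] is at least the value of the formula. *)
have h : gauss_tail ((a + A + d) / Num.sqrt (2 * v)) <= chip_potential A v (a + d).
  rewrite /chip_potential addrAC; case: ifPn => // ad.
  by rewrite gauss_tail_le1// divr_ge0 ?(ltW r0)//; lra.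
have d2 : `|d| <= 2 by rewrite ler_norml; apply/andP; split; lra.
have aA0 : 0 <= a + A by lra.
have := gauss_tail_heat_step v1 aA0 d2 erefl.
rewrite ler_norml => /andP[+ _]; rewrite -/(chip_weight v (a + A)).
have /andP[c0 c1] := @gauss_curv_bound _ ((a + A) / Num.sqrt (2 * v))
  (divr_ge0 aA0 (ltW r0)).
set c := gauss_curv _ in c0 c1 *.
have dg := ler_div_sqrt_gap v1 G0 dG.
have vi0 : 0 < v^-1 by rewrite invr_gt0; lra.
have : - (4 * G * gauss_coef R * sqrt_gap v) - m * (gauss_coef R / 2 / v)
    <= c * (d ^+ 2 - 1) / (4 * v).
  have -> : c * (d ^+ 2 - 1) / (4 * v) = c / 4 * ((d ^+ 2 - 1) / v).
    by field; rewrite gt_eqF//; lra.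
  have dv0 : 0 <= delta / v by rewrite divr_ge0//; lra.
  (* A margin of [1] or [-1] gives [d^2 - 1 >= - 2 delta]; otherwise [m = 1] pays for the trivial
     bound [d^2 - 1 >= -1]. *)
  have dd : - (2 * (delta / v) + m / v) <= (d ^+ 2 - 1) / v.
    rewrite mulrA -mulrDl -mulNr ler_pM2r//.
    have d20 := sqr_ge0 d; have dl20 := sqr_ge0 delta.
    case: dm => [/eqP|->]; last by lra.
    rewrite eqr_norml => /andP[/orP[/eqP dE|/eqP dE] _].
      by have -> : d = 1 - delta by [lra]; nra.
    by have -> : d = - 1 - delta by [lra]; nra.
  have mv0 : 0 <= m / v by rewrite divr_ge0//; lra.
  apply: (@le_trans _ _ (c / 4 * - (2 * (delta / v) + m / v))); last first.
    by rewrite ler_wpM2l//; lra.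
  apply: (@le_trans _ _ (2 * gauss_coef R / 4 * - (2 * (delta / v) + m / v))).
    by nra.
  by rewrite ler_wnM2r//; lra.
by lra.
Qed.

(** * Vertices of sections of a cube *)

Definition fractional (R : realFieldType) (N : nat) (L : {set 'I_N})
    (b : 'rV[R]_N) : {set 'I_N} := [set i in L | `|b 0 i| < 1].

(** Starting at [b] in the direction [e], stop when the first moving coordinate reaches a face of
    the cube. That coordinate ceases to be fractional, and no coordinate at rest becomes so. *)
Lemma slide_to_boundary (R : realFieldType) (N : nat) (L : {set 'I_N})
    (b e : 'rV[R]_N) :
  (forall i, i \in L -> `|b 0 i| <= 1) ->
  (forall i, i \notin fractional L b -> e 0 i = 0) -> e != 0 ->
  exists t : R, (forall i, i \in L -> `|(b + t *: e) 0 i| <= 1) /\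
    (#|fractional L (b + t *: e)| < #|fractional L b|)%N.
Proof.
move=> b1 eF /eqP eN0.
have [i0 ei0] : exists i0, e 0 i0 != 0.
  apply/existsP; rewrite -negb_forall; apply/negP => /forallP e0; apply: eN0.
  by apply/rowP => i; rewrite mxE; apply/eqP.
(* The time at which a moving coordinate [i] reaches the face [Num.sg (e 0 i)] ahead of it. *)
pose hit i := (Num.sg (e 0 i) - b 0 i) / e 0 i.
have inF i : e 0 i != 0 -> (i \in L) && (`|b 0 i| < 1).
  by move=> ei; apply: contraNT ei => iF; rewrite eF// inE.
case: (@arg_minP _ _ _ i0 (fun i => e 0 i != 0) hit ei0) => i1 ei1 hit_min.
exists (hit i1); split=> [i iL|].
  rewrite !mxE; have [->|ei] := eqVneq (e 0 i) 0; first by rewrite mulr0 addr0 b1.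
  have ti := hit_min _ ei.
  have /andP[_] := inF _ ei; rewrite ltr_norml => /andP[bi0 bi1].
  have t0 : 0 <= hit i1.
    have /andP[_] := inF _ ei1; rewrite ltr_norml => /andP[b0 b2].
    rewrite /hit; have [e0|e0|e0] := ltgtP 0 (e 0 i1).
    - by rewrite gtr0_sg// divr_ge0 ?(ltW e0)//; lra.
    - by rewrite ltr0_sg// mulr_le0 ?invr_le0 ?(ltW e0)//; lra.
    - by rewrite e0 eqxx in ei1.
  rewrite ler_norml.
  have [e0|e0|e0] := ltgtP 0 (e 0 i).
  - have : hit i1 * e 0 i <= 1 - b 0 i.
      by rewrite -ler_pdivlMr//; move: ti; rewrite {2}/hit gtr0_sg.
    by have := mulr_ge0 t0 (ltW e0) => ? ?; apply/andP; split; lra.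
  - have : -1 - b 0 i <= hit i1 * e 0 i.
      by rewrite -ler_ndivlMr//; move: ti; rewrite {2}/hit ltr0_sg.
    by have := mulr_ge0_le0 t0 (ltW e0) => ? ?; apply/andP; split; lra.
  - by rewrite e0 eqxx in ei.
apply: proper_card; apply/properP; split.
  apply/fintype.subsetP => i; rewrite inE => /andP[iL].
  apply: contraTT => iF; rewrite !mxE eF// mulr0 addr0.
  by move: iF; rewrite inE iL.
exists i1; first by rewrite inE inF.
rewrite inE !mxE /hit divfK// addrC subrK normr_sg ei1 ltxx andbF.
by [].
Qed.

(** Dimension count: the [m] columns of [M] impose [m] linear conditions on [#|F|] free
    coordinates. *)
Lemma supported_kernel_vector (R : fieldType) (N m : nat) (F : {set 'I_N})
    (M : 'M[R]_(N, m)) : (m < #|F|)%N ->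
  exists e : 'rV[R]_N,
    [/\ e != 0, forall i, i \notin F -> e 0 i = 0 & e *m M = 0].
Proof.
move=> mF; pose S : 'M[R]_(#|F|, N) := \matrix_(i, j) (enum_val i == j)%:R.
have kN0 : kermx (S *m M) != 0.
  rewrite -mxrank_eq0 mxrank_ker subn_eq0 -ltnNge.
  exact: leq_ltn_trans (rank_leq_col _) mF.
pose u := nz_row (kermx (S *m M)).
have uN0 : u != 0 by rewrite nz_row_eq0.
have uS : u *m S *m M = 0.
  by rewrite -mulmxA; apply/sub_kermxP; exact: nz_row_sub.
exists (u *m S); split => //.
- apply: contraNneq uN0 => uS0; apply/eqP/rowP => k; rewrite mxE.
  have := congr1 (fun A : 'rV_N => A 0 (enum_val k)) uS0; rewrite !mxE => <-.
  rewrite (bigD1 k)//= mxE eqxx mulr1 big1 ?addr0// => j jk.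
  by rewrite mxE (inj_eq enum_val_inj) (negPf jk) mulr0.
- move=> i iF; rewrite mxE big1// => k _; rewrite mxE.
  have [ki|_] := eqVneq (enum_val k) i; last by rewrite mulr0.
  by rewrite -ki enum_valP in iF.
Qed.

(** As at a vertex of a cube cut by [m] equations. The proof is a descent: while more than [m]
    coordinates are fractional, a kernel direction supported on them lowers their number and
    preserves [b *m M]. *)
Lemma few_fractional (R : realFieldType) (N m : nat) (L : {set 'I_N})
    (M : 'M[R]_(N, m)) (b0 : 'rV[R]_N) :
  (forall i, i \in L -> `|b0 0 i| <= 1) ->
  exists b : 'rV[R]_N, [/\ forall i, i \in L -> `|b 0 i| <= 1,
    forall i, i \notin L -> b 0 i = b0 0 i, b *m M = b0 *m M &
    (#|fractional L b| <= m)%N].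
Proof.
have [n] := ubnP #|fractional L b0|; elim: n => // n IH in b0 * => bn b1.
have [Fm|mF] := leqP #|fractional L b0| m; first by exists b0.
have [e [eN0 eF eM]] := supported_kernel_vector M mF.
have [t [bt1 Flt]] := slide_to_boundary b1 eF eN0.
have [b [bL bN bM bF]] := IH _ (leq_trans Flt bn) bt1.
exists b; split => // [i iL|].
  rewrite bN// !mxE eF ?mulr0 ?addr0// inE negb_and iL//.
by rewrite bM mulmxDl -scalemxAl eM scaler0 addr0.
Qed.

(** * Rounds of the game *)

Lemma derive1_potential (R : realType) (delta : R) (T : nat) (s v : R) :
  0 < v -> - (delta * T%:R) < s ->
  derive1 (fun u : R => potential delta T u (- v)) s =
  - chip_weight v (s + delta * T%:R).
Proof.
move=> v0 s0; set r := Num.sqrt (2 * v).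
have r0 : 0 < r by rewrite sqrtr_gt0 mulr_gt0.
have Hs : is_derive s 1 (fun u : R => r^-1 * (u + delta * T%:R)) r^-1.
  have := is_deriveZ r^-1 (is_deriveD (is_derive_id s 1)
    (is_derive_cst (delta * T%:R : R^o) s 1)).
  by rewrite /GRing.scale/= addr0 mulr1.
have Hc := @is_derive1_comp _ (@gauss_tail R) _ s _ _ (is_derive_gauss_tail _) Hs.
have Hp : is_derive s 1 (fun u : R => potential delta T u (- v))
    (- chip_weight v (s + delta * T%:R)).
  apply: (@near_eq_is_derive _ _ _ (@gauss_tail R \o
    (fun u : R => r^-1 * (u + delta * T%:R)))).
    near=> u.
    have us : - (delta * T%:R) < u by near: u; exact: lt_nbhsr.
    by rewrite /potential us /= mulrN opprK -/r mulrC.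
  apply: is_derive_eq Hc _.
  by rewrite /chip_weight -/r [r^-1 * _]mulrC mulNr.
by rewrite derive1E; apply: derive_val.
Unshelve. all: by end_near. Qed.

(** With [t = size H - T], the time [t + 1 - tau] of the player's rule is [- v], where [v] is the
    time remaining after the round plus the offset [tau]. *)
Lemma boosting_weightE (R : realType) (N : nat) (X : Type) (delta theta : R)
    (T : nat) (x : 'I_N -> X) (y : 'I_N -> R) (H : history R N X) (i : 'I_N)
    (v : R) : 0 < v -> v = T%:R `^ theta + T%:R - (size H).+1%:R ->
  let a := chip_position delta x y H i + delta * T%:R in
  boosting_weight delta theta T x y H i = if 0 < a then chip_weight v a else 0.
Proof.
move=> v0 vE a; rewrite /boosting_weight.
have -> : (chip_position delta x y H i <= - (delta * T%:R)) = ~~ (0 < a).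
  by rewrite -leNgt -subr_ge0 -[RHS]oppr_ge0 /a opprD addrC.
rewrite if_neg; case: ifP => // a0.
have -> : (size H)%:R - T%:R + 1 - T%:R `^ theta = - v.
  by rewrite vE -natr1; ring.
by rewrite derive1_potential ?opprK// -subr_gt0 opprK.
Qed.

Lemma chip_position_rcons (R : realType) (N : nat) (X : Type) (delta : R)
    (x : 'I_N -> X) (y : 'I_N -> R) (H : history R N X) (r : round R N X) i :
  chip_position delta x y (rcons H r) i =
  chip_position delta x y H i + (y i * r.2 (x i) - delta).
Proof. by rewrite /chip_position -cats1 big_cat big_seq1. Qed.

(** At the end of the game [a = s + delta T] is thus the total margin of the vote, and the dead
    chips are exactly the misclassified samples. *)
Lemma chip_position_margin (R : realType) (N : nat) (X : Type) (delta : R)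
    (x : 'I_N -> X) (y : 'I_N -> R) (H : history R N X) i :
  chip_position delta x y H i + delta * (size H)%:R =
  \sum_(r <- H) y i * r.2 (x i).
Proof.
rewrite /chip_position big_split /= sumrN big_const_seq count_predT.
by rewrite iter_addr_0 mulr_natr subrK.
Qed.

Lemma size_play (R : realType) (N : nat) (X : Type)
    (sigma : history R N X -> 'I_N -> R)
    (alpha : history R N X -> ('I_N -> R) -> X -> R) k :
  size (play sigma alpha k) = k.
Proof. by elim: k => //= k IH; rewrite size_rcons IH. Qed.

(** * Weak hypotheses in terms of margins *)

Lemma is_weak_hypothesisE (R : realType) (N : nat) (X : Type) (delta : R)
    (x : 'I_N -> X) (y : 'I_N -> R) (p : 'I_N -> R) (h : X -> R) :
  (forall i, y i = -1 \/ y i = 1) ->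
  is_weak_hypothesis delta x y p h <->
  (forall z, -1 <= h z <= 1) /\ delta <= \sum_i p i * (y i * h (x i)).
Proof.
move=> y1; rewrite /is_weak_hypothesis.
suff -> : \sum_(i | 0 < y i * h (x i)) p i * `|h (x i)|
    - \sum_(j | y j * h (x j) <= 0) p j * `|h (x j)|
    = \sum_i p i * (y i * h (x i)) by [].
have yh i : `|h (x i)| = `|y i * h (x i)|.
  by case: (y1 i) => ->; rewrite ?mul1r// mulN1r normrN.
rewrite [RHS](bigID (fun i => 0 < y i * h (x i))) /=; congr (_ + _).
  by apply: eq_bigr => i yh0; rewrite yh gtr0_norm.
rewrite -sumrN; apply: eq_big => [i|i yh0]; first by rewrite leNgt.
by rewrite yh ler0_norm// mulrN opprK.
Qed.

Lemma hypothesis_of_margins (R : realType) (N : nat) (X : Type)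
    (x : 'I_N -> X) (y b : 'I_N -> R) : injective x ->
  (forall i, y i = -1 \/ y i = 1) -> (forall i, `|b i| <= 1) ->
  exists h : X -> R,
    (forall i, y i * h (x i) = b i) /\ (forall z, -1 <= h z <= 1).
Proof.
move=> xI y1 b1.
(* On a sample the value [y i * b i] works since [y i ^ 2 = 1], and injectivity of [x] makes it
   unambiguous; [0] is a default value elsewhere. *)
exists (fun z => if pselect (exists i, x i = z) is left e
  then y (projT1 (cid e)) * b (projT1 (cid e)) else 0); split.
  move=> i; case: pselect => [e|[]]; last by exists i.
  case: (cid e) => j /= /xI ->; rewrite mulrA.
  by case: (y1 i) => ->; rewrite ?mulrNN mulr1 mul1r.
move=> z; rewrite -ler_norml; case: pselect => [e|_]; last by rewrite normr0.
case: (cid e) => j /= _.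
by case: (y1 j) => ->; rewrite ?mulN1r ?normrN ?mul1r.
Qed.

(** * Change of the total potential in one round *)

Definition total_potential (R : realType) (N : nat) (X : Type) (A v delta : R)
    (T : nat) (x : 'I_N -> X) (y : 'I_N -> R) (H : history R N X) : R :=
  \sum_i chip_potential A v (chip_position delta x y H i + delta * T%:R).

Lemma player_round (R : realType) (N : nat) (X : Type) (G delta theta v : R)
    (T : nat) (x : 'I_N -> X) (y p : 'I_N -> R) (h : X -> R) (H : history R N X) :
  1 <= v -> v = T%:R `^ theta + T%:R - (size H).+1%:R ->
  0 <= delta <= 1 -> delta * Num.sqrt v <= G ->
  (forall i, y i = -1 \/ y i = 1) -> is_prob p ->
  is_weak_hypothesis delta x y p h ->
  obeys_boosting_rule delta theta T x y H p ->
  total_potential 0 v delta T x y (rcons H (p, h)) <=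
  total_potential 0 (v + 1) delta T x y H
    + N%:R * ((84 + 6 * G) * gauss_coef R * sqrt_gap v).
Proof.
move=> v1 vE dl dG y1 [p0 psum] /(is_weak_hypothesisE _ _ _ _ y1)[h1 hp] rule.
have v0 : 0 < v by lra.
set K := _ * sqrt_gap v.
pose a i := chip_position delta x y H i + delta * T%:R.
pose d i := y i * h (x i) - delta.
have pd : 0 <= \sum_i p i * d i.
  rewrite /d; under eq_bigr do rewrite mulrBr.
  by rewrite big_split /= sumrN -mulr_suml psum mul1r subr_ge0.
(* The edge condition divided by [c] says that the first-order terms have a nonnegative sum; if no
   chip is alive, every term is [0]. *)
have wd : 0 <= \sum_i (if 0 < a i then chip_weight v (a i) * d i else 0).
  have [[i ai]|live] := pselect (exists i, 0 < a i); last first.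
    rewrite big1// => i _; case: ifP => // ai.
    by case: live; exists i.
  have [|c pc] := rule.
    by exists i; rewrite -subr_gt0 opprK.
  have pcE j : p j = c * (if 0 < a j then chip_weight v (a j) else 0).
    by rewrite pc (@boosting_weightE _ _ _ _ _ _ _ _ _ _ v).
  (* The rule does not state the sign of [c]; it is positive because the weights are nonnegative and
     [p] sums to [1]. *)
  have c0 : 0 < c.
    have S0 : 0 <= \sum_j (if 0 < a j then chip_weight v (a j) else 0).
      by apply: sumr_ge0 => j _; case: ifP => // _; exact/ltW/chip_weight_gt0.
    have : c * \sum_j (if 0 < a j then chip_weight v (a j) else 0) = 1.
      by rewrite mulr_sumr -psum; apply: eq_bigr => j _; rewrite pcE.
    move=> cS; rewrite ltNge; apply/negP => c0.
    by have := mulr_le0_ge0 c0 S0; rewrite cS ler10.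
  rewrite -(pmulr_rge0 _ c0) mulr_sumr; apply: le_trans pd _.
  by apply: ler_sum => j _; rewrite pcE -mulrA; case: ifP => _; rewrite ?mul0r.
have -> : N%:R * K = \sum_(i < N) K by rewrite sumr_const card_ord mulr_natl.
have step i : chip_potential 0 v (a i + d i) <= chip_potential 0 (v + 1) (a i)
    - (if 0 < a i then chip_weight v (a i) * d i else 0) + K.
  apply: (chip_potential_step_le _ v1 dl dG).
  have := h1 (x i); rewrite /d => /andP[h2 h3].
  by case: (y1 i) => ->; apply/andP; split; lra.
have -> : total_potential 0 v delta T x y (rcons H (p, h)) =
    \sum_i chip_potential 0 v (a i + d i).
  by apply: eq_bigr => i _; rewrite chip_position_rcons addrAC.
apply: (le_trans (ler_sum _ (fun i _ => step i))).
by rewrite !big_split /= sumrN /total_potential lerD2r gerBl.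
Qed.

(** The conditions on [v], [A] and [G] restrict only the estimate, not the choice of [b]: a strategy
    must answer every history legally, also one longer than the game. *)
Lemma adversary_move (R : realType) (N : nat) (delta A v : R) (a p : 'I_N -> R) :
  0 <= delta <= 1 ->
  exists b : 'I_N -> R, [/\ forall i, `|b i| <= 1,
    \sum_i p i * (b i - delta) = 0 &
    forall G : R, 1 <= v -> 2 <= A -> delta * Num.sqrt v <= G ->
      Num.sqrt v <= G * N%:R ->
      \sum_i chip_potential A (v + 1) (a i)
        - N%:R * ((84 + 8 * G) * gauss_coef R * sqrt_gap v) <=
      \sum_i chip_potential A v (a i + (b i - delta))].
Proof.
move=> dl; have /andP[dl0 dl1] := dl.
pose L := finset (fun i => 0 < a i).
(* The columns are the player's probabilities and the weights of the potential at the shifted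
   positions, with zero rows for dead chips. Keeping [b *m M] as at the starting point [b = delta]
   makes both first-order sums vanish. *)
pose M : 'M[R]_(N, 2) := \matrix_(i, j)
  (if i \in L then if j == 0 then p i else chip_weight v (a i + A) else 0).
have [|b [bL bN bM bF]] := @few_fractional _ _ _ L M (const_mx delta).
  by move=> i _; rewrite mxE ger0_norm.
have dE i : 0 < a i \/ b 0 i = delta.
  have [iL|iL] := boolP (i \in L); first by left; rewrite inE in iL.
  by right; rewrite bN// mxE.
have ME j : \sum_i M i j * (b 0 i - delta) = 0.
  have E := congr1 (fun B : 'rV_2 => B 0 j) bM; rewrite /= !mxE in E.
  transitivity (\sum_i b 0 i * M i j - \sum_i (const_mx delta : 'rV_N) 0 i * M i j).
    rewrite -sumrB; apply: eq_bigr => i _.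
    by rewrite [const_mx _ _ _]mxE -mulrBl mulrC.
  by rewrite E subrr.
have b1 i : `|b 0 i| <= 1.
  have [iL|iL] := boolP (i \in L); first exact: bL.
  by rewrite bN// mxE ger0_norm.
exists (b 0); split => //.
  rewrite -[RHS](ME 0); apply: eq_bigr => i _; rewrite mxE eqxx.
  case: ifPn => // iL; rewrite mul0r.
  by have [ai|->] := dE i; [rewrite inE ai in iL|rewrite subrr mulr0].
move=> G v1 A2 dG NG.
have G0 : 0 <= G by apply: le_trans dG; rewrite mulr_ge0 ?sqrtr_ge0.
have k0 := gauss_coef_gt0 R; have g0 := sqrt_gap_ge0 v1.
pose K := (84 + 4 * G) * gauss_coef R * sqrt_gap v.
have K0 : 0 <= K by rewrite !mulr_ge0 ?(ltW k0)//; lra.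
pose frac i : R := (i \in fractional L b)%:R.
have step i : chip_potential A (v + 1) (a i) - M i 1 * (b 0 i - delta)
    - K - frac i * (gauss_coef R / 2 / v) <=
    chip_potential A v (a i + (b 0 i - delta)).
  have f01 : 0 <= frac i <= 1 by rewrite ler0n lern1 leq_b1.
  rewrite mxE inE; case: ifPn => [ai|ai].
    rewrite /=; apply: (chip_potential_step_ge v1 A2 dl dG _ f01) => //.
      by have := b1 i; rewrite ler_norml => /andP[b2 b3]; apply/andP; split; lra.
    rewrite subrK /frac !inE ai /=.
    by have := b1 i; rewrite le_eqVlt => /orP[/eqP|->]; [left|right].
  have [|->] := dE i; first by rewrite (negPf ai).
  rewrite subrr addr0 mulr0 subr0 /chip_potential (negPf ai).
  have : 0 <= frac i * (gauss_coef R / 2 / v).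
    have /andP[f0 _] := f01.
    by rewrite mulr_ge0// !divr_ge0 ?(ltW k0)//; lra.
  by lra.
apply: le_trans (ler_sum _ (fun i _ => step i)).
rewrite !sumrB ME subr0 sumr_const card_ord -mulr_suml.
have -> : \sum_i frac i = #|fractional L b|%:R.
  by rewrite /frac -natr_sum -sum1_card [in RHS]big_mkcond.
have c2 : #|fractional L b|%:R * (gauss_coef R / 2 / v) <= gauss_coef R / v.
  have -> : gauss_coef R / v = 2%:R * (gauss_coef R / 2 / v).
    by field; rewrite gt_eqF//; lra.
  by rewrite ler_wpM2r ?ler_nat// !divr_ge0 ?(ltW k0)//; lra.
(* The cost of the at most two fractional chips is spread over all [N] chips: [sqrt v <= G * N]
   turns it into a further [4 G] per chip, hence [8 G] in place of [4 G]. *)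
have NG0 : 0 <= G * N%:R by rewrite mulr_ge0.
have := @ler_div_sqrt_gap _ 1 (G * N%:R) v v1 NG0.
rewrite !mul1r => /(_ NG) vN.
have kv : gauss_coef R / v <= gauss_coef R * (4 * (G * N%:R) * sqrt_gap v).
  by rewrite ler_pM2l.
have arith (S r s t : R) : s + t <= r -> S - r <= S - s - t.
  by move=> ?; lra.
apply: arith; rewrite -[K *+ N]mulr_natl.
have -> : (84 + 8 * G) * gauss_coef R * sqrt_gap v =
  K + gauss_coef R * (4 * G * sqrt_gap v) by rewrite /K; ring.
rewrite mulrDr lerD2l (le_trans c2)// (le_trans kv)// le_eqVlt.
by apply/orP; left; apply/eqP; ring.
Qed.

(** * The whole game *)

Lemma sqrt_gap_telescope (R : realType) (T : nat) (f : nat -> R) (c tau : R) :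
  0 <= c ->
  (forall k, (k < T)%N ->
    f k.+1 <= f k + c * sqrt_gap (tau + T%:R - k.+1%:R)) ->
  f T <= f 0%N + c / Num.sqrt tau.
Proof.
move=> c0 fS.
have tel k : (k <= T)%N -> f k <= f 0%N +
    c * ((Num.sqrt (tau + T%:R - k%:R))^-1 - (Num.sqrt (tau + T%:R))^-1).
  elim: k => [_|k IH kT]; first by rewrite subr0 subrr mulr0 addr0.
  have := fS k kT; have := IH (ltnW kT); rewrite /sqrt_gap.
  have -> : tau + T%:R - k.+1%:R + 1 = tau + T%:R - k%:R :> R.
    by rewrite -natr1; ring.
  by rewrite !mulrBr; lra.
have := tel T (leqnn T); rewrite addrK mulrBr.
have : 0 <= c / Num.sqrt (tau + T%:R) by rewrite divr_ge0 ?sqrtr_ge0.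
by lra.
Qed.

Lemma total_potential_nil (R : realType) (N : nat) (X : Type) (A v delta : R)
    (T : nat) (x : 'I_N -> X) (y : 'I_N -> R) :
  total_potential A v delta T x y [::] =
  N%:R * chip_potential A v (delta * T%:R).
Proof.
rewrite /total_potential; under eq_bigr do
  rewrite /chip_position big_nil add0r.
by rewrite sumr_const card_ord mulr_natl.
Qed.

Lemma training_errorE (R : realType) (N : nat) (X : Type) (delta : R)
    (T : nat) (x : 'I_N -> X) (y : 'I_N -> R) (H : history R N X) :
  size H = T ->
  training_error x y H =
  N%:R^-1 * \sum_i (chip_position delta x y H i + delta * T%:R <= 0)%R%:R.
Proof.
move=> <-; congr (_ * _); apply: eq_bigr => i _.
by rewrite chip_position_margin.
Qed.

Lemma adversary_reply (R : realType) (N : nat) (X : Type) (delta A v : R)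
    (T : nat) (x : 'I_N -> X) (y p : 'I_N -> R) (H : history R N X) :
  0 <= delta <= 1 -> injective x -> (forall i, y i = -1 \/ y i = 1) ->
  exists h : X -> R, (is_prob p -> is_weak_hypothesis delta x y p h) /\
    forall G : R, 1 <= v -> 2 <= A -> delta * Num.sqrt v <= G ->
      Num.sqrt v <= G * N%:R ->
      total_potential A (v + 1) delta T x y H
        - N%:R * ((84 + 8 * G) * gauss_coef R * sqrt_gap v) <=
      total_potential A v delta T x y (rcons H (p, h)).
Proof.
move=> dl xI y1.
have [b [b1 bp bG]] := adversary_move A v
  (fun i => chip_position delta x y H i + delta * T%:R) p dl.
have [h [hb h1]] := hypothesis_of_margins xI y1 b1.
exists h; split=> [[_ psum]|G v1 A2 dG NG].
  apply/(is_weak_hypothesisE _ _ _ _ y1); split => //.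
  rewrite -subr_ge0 -{1}[delta]mul1r -psum mulr_suml -sumrB.
  rewrite (eq_bigr (fun i => p i * (b i - delta))) ?bp// => i _.
  by rewrite hb mulrBr.
apply: le_trans (bG G v1 A2 dG NG) _; rewrite le_eqVlt; apply/orP; left.
apply/eqP/eq_bigr => i _.
by rewrite chip_position_rcons hb addrAC.
Qed.

Lemma sqrt_powR (R : realType) (x e : R) :
  Num.sqrt (x `^ e) = x `^ (e / 2).
Proof. by rewrite -powR12_sqrt ?powR_ge0// -powRrM. Qed.

(** * Bounds in terms of [gamma], and the potential at the start *)

Section Horizon.
Variables (R : realType) (gamma delta : R) (T : nat).
Hypotheses (gamma_ge0 : 0 <= gamma) (delta_ge0 : 0 <= delta) (T_gt0 : (0 < T)%N)
  (gammaE : gamma = delta ^+ 2 * T%:R / 2).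

Lemma gamma_horizon : (delta * T%:R) ^+ 2 = 2 * gamma * T%:R.
Proof. by rewrite gammaE; field. Qed.

Lemma delta_sqrt_bound (v : R) : 0 <= v <= 2 * T%:R ->
  delta * Num.sqrt v <= 2 * Num.sqrt gamma.
Proof.
move=> /andP[v0 v1]; rewrite -(@ler_pXn2r _ 2) ?nnegrE ?mulr_ge0 ?sqrtr_ge0//.
rewrite !exprMn !sqr_sqrtr// gammaE.
have := ler_wpM2l (sqr_ge0 delta) v1; lra.
Qed.

(** The argument on the left is [sqrt (gamma T / (tau + T))], which is at least
    [sqrt gamma (1 - tau / T)]; the rest is the Lipschitz bound. *)
Lemma gauss_tail_start_le (tau : R) : 0 <= tau ->
  gauss_tail (delta * T%:R / Num.sqrt (2 * (tau + T%:R))) <=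
  gauss_tail (Num.sqrt gamma) + gauss_coef R * Num.sqrt gamma * (tau / T%:R).
Proof.
move=> tau0; have T0 : 0 < T%:R :> R by rewrite ltr0n.
set g := Num.sqrt gamma; set q := _ / Num.sqrt _.
have g0 : 0 <= g by rewrite sqrtr_ge0.
have q0 : 0 <= q by rewrite divr_ge0 ?mulr_ge0 ?sqrtr_ge0.
have sT : 0 < tau + T%:R by lra.
have qE : q ^+ 2 = gamma * T%:R / (tau + T%:R).
  rewrite expr_div_n sqr_sqrtr ?gamma_horizon; last by lra.
  by field; rewrite gt_eqF.
have gq : g - g * (tau / T%:R) <= q.
  apply: (@le_trans _ _ (g * T%:R / (tau + T%:R))).
    rewrite ler_pdivlMr//.
    have -> : (g - g * (tau / T%:R)) * (tau + T%:R) =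
        g * T%:R - g * tau ^+ 2 / T%:R by field; rewrite gt_eqF.
    by rewrite gerBl divr_ge0 ?(ltW T0)// mulr_ge0// sqr_ge0.
  rewrite -(@ler_pXn2r _ 2) ?nnegrE ?divr_ge0 ?mulr_ge0 ?(ltW sT)//.
  rewrite qE expr_div_n exprMn sqr_sqrtr// ler_pdivrMr ?exprn_gt0//.
  have -> : gamma * T%:R / (tau + T%:R) * (tau + T%:R) ^+ 2 =
      gamma * T%:R * (tau + T%:R) by field; rewrite gt_eqF.
  by rewrite expr2 -mulrA ler_wpM2l// ler_wpM2l ?(ltW T0)//; lra.
have qg : q <= g.
  rewrite -(@ler_pXn2r _ 2) ?nnegrE// qE sqr_sqrtr// ler_pdivrMr//.
  by rewrite ler_wpM2l//; lra.
have := gauss_tail_lipschitz g q; rewrite ler_norml => /andP[_].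
rewrite distrC ger0_norm ?subr_ge0// => h.
have k0 := gauss_coef_gt0 R.
have := ler_wpM2l (ltW k0) (_ : g - q <= g * (tau / T%:R)) => H.
have {H}H : gauss_coef R * (g - q) <= gauss_coef R * (g * (tau / T%:R)).
  by apply: H; lra.
by rewrite -mulrA; lra.
Qed.

(** Dropping the offset [tau] increases the argument and so lowers the tail. The argument becomes
    [sqrt gamma + A / sqrt (2 T)], and the Lipschitz bound applies. *)
Lemma gauss_tail_start_ge (A tau : R) : 0 <= A -> 0 <= tau ->
  gauss_tail (Num.sqrt gamma) - gauss_coef R * (A / Num.sqrt T%:R) <=
  gauss_tail ((delta * T%:R + A) / Num.sqrt (2 * (tau + T%:R))).
Proof.
move=> A0 tau0; have T0 : 0 < T%:R :> R by rewrite ltr0n.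
have k0 := gauss_coef_gt0 R.
have r0 : 0 < Num.sqrt (2 * T%:R : R) by rewrite sqrtr_gt0 mulr_gt0.
set g := Num.sqrt gamma.
have dT0 : 0 <= delta * T%:R by rewrite mulr_ge0.
apply: (@le_trans _ _ (gauss_tail ((delta * T%:R + A) / Num.sqrt (2 * T%:R)))).
  have -> : (delta * T%:R + A) / Num.sqrt (2 * T%:R) = g + A / Num.sqrt (2 * T%:R).
    rewrite mulrDl; congr (_ + _); apply/eqP; rewrite eq_le.
    apply/andP; split; rewrite -(@ler_pXn2r _ 2) ?nnegrE ?divr_ge0 ?sqrtr_ge0//.
      by rewrite expr_div_n gamma_horizon !sqr_sqrtr ?mulr_ge0 ?ler0n// ler_pdivrMr ?mulr_gt0//; lra.
    by rewrite expr_div_n gamma_horizon !sqr_sqrtr ?mulr_ge0 ?ler0n// ler_pdivlMr ?mulr_gt0//; lra.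
  have := gauss_tail_lipschitz g (g + A / Num.sqrt (2 * T%:R)).
  rewrite ler_norml => /andP[+ _]; rewrite addrAC subrr add0r.
  rewrite ger0_norm ?divr_ge0 ?sqrtr_ge0// => h.
  have : gauss_coef R * (A / Num.sqrt (2 * T%:R)) <= gauss_coef R * (A / Num.sqrt T%:R).
    rewrite ler_pM2l// ler_wpM2l// lef_pV2 ?posrE ?sqrtr_gt0 ?mulr_gt0//.
    by rewrite ler_wsqrtr//; lra.
  by lra.
apply: gauss_tail_antitone; apply: ler_wpM2l; first by rewrite addr_ge0.
rewrite lef_pV2 ?posrE ?sqrtr_gt0 ?mulr_gt0//; last by lra.
by rewrite ler_wsqrtr//; lra.
Qed.

End Horizon.

(** * Bounds on the training error after [T] rounds *)

Lemma player_guarantee (R : realType) (theta gamma delta : R) (T N : nat)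
    (X : Type) (x : 'I_N -> X) (y : 'I_N -> R)
    (sigma : history R N X -> 'I_N -> R)
    (alpha : history R N X -> ('I_N -> R) -> X -> R) :
  0 < theta < 2 / 3 -> 0 <= gamma -> (0 < T)%N -> (0 < N)%N ->
  0 <= delta < 1 -> gamma = delta ^+ 2 * T%:R / 2 ->
  (forall i, y i = -1 \/ y i = 1) ->
  player_strategy sigma -> adversary_strategy delta x y alpha ->
  (forall k, (k < T)%N -> obeys_boosting_rule delta theta T x y
    (play sigma alpha k) (sigma (play sigma alpha k))) ->
  training_error x y (play sigma alpha T) <= gauss_tail (Num.sqrt gamma) +
    gauss_coef R * (84 + 13 * Num.sqrt gamma) * T%:R `^ (- (theta / 2)).
Proof.
move=> /andP[th0 th1] ga0 T0 N0 /andP[dl0 dl1] gaE y1 sigmaP alphaP rule.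
have N0R : 0 < N%:R :> R by rewrite ltr0n.
have T1 : 1 <= T%:R :> R by rewrite ler1n.
have k0 := gauss_coef_gt0 R; have g0 := sqrtr_ge0 gamma.
set tau := T%:R `^ theta.
have tau1 : 1 <= tau by rewrite -(powRr0 T%:R) ler_powR// ltW.
have tauT : tau <= T%:R by apply: ler1_powR => //; lra.
pose f k := total_potential 0 (tau + T%:R - k%:R) delta T x y (play sigma alpha k).
pose K := (84 + 6 * (2 * Num.sqrt gamma)) * gauss_coef R.
have K0 : 0 <= K by rewrite mulr_ge0 ?(ltW k0)//; lra.
have fT : f T <= f 0%N + N%:R * K / Num.sqrt tau.
  apply: sqrt_gap_telescope; first by rewrite mulr_ge0.
  move=> k kT; rewrite /f /= -[in leRHS]mulrA.
  have kT' : k.+1%:R <= T%:R :> R by rewrite ler_nat.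
  have kp : 1 <= k.+1%:R :> R by rewrite ler1n.
  have -> : tau + T%:R - k%:R = tau + T%:R - k.+1%:R + 1 :> R.
    by rewrite -natr1; ring.
  apply: (@player_round _ _ _ _ _ theta) => //.
  - by lra.
  - by rewrite size_play.
  - by rewrite dl0 ltW.
  - by apply: (@delta_sqrt_bound _ _ _ T) => //; apply/andP; split; lra.
  - exact/alphaP/sigmaP.
  - exact: rule.
have f0 : f 0%N <= N%:R * (gauss_tail (Num.sqrt gamma) +
    gauss_coef R * Num.sqrt gamma * (tau / T%:R)).
  rewrite /f subr0 total_potential_nil ler_pM2l//.
  apply: le_trans (@gauss_tail_start_le _ _ _ _ ga0 dl0 T0 gaE tau _); last by lra.
  (* With [delta = 0] the chips start on the boundary, where the value [1] agrees with
     [gauss_tail 0]. *)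
  rewrite /chip_potential addr0; case: ifPn => // dT.
  have -> : delta * T%:R = 0.
    by apply/eqP; rewrite eq_le leNgt dT mulr_ge0.
  by rewrite mul0r gauss_tail0.
have err : N%:R * training_error x y (play sigma alpha T) <= f T.
  rewrite (training_errorE delta _ _ (size_play sigma alpha T)) mulVKf ?gt_eqF//.
  apply: ler_sum => i _; rewrite addrK /chip_potential.
  by case: ltP => // _; apply: gauss_tail_ge0.
have e1 : (Num.sqrt tau)^-1 = T%:R `^ (- (theta / 2)).
  by rewrite sqrt_powR powRN.
(* The exponents satisfy [theta - 1 <= - theta / 2] because [theta < 2 / 3]. *)
have e2 : tau / T%:R <= T%:R `^ (- (theta / 2)).
  have -> : tau / T%:R = T%:R `^ (theta - 1).
    by rewrite powRB ?powRr1// pnatr_eq0 -lt0n T0 implybT.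
  by apply: ler_powR => //; lra.
rewrite -(ler_pM2l N0R); apply: (le_trans err); apply: (le_trans fT).
apply: (le_trans (lerD f0 (lexx _))).
(* [K] contributes [84 + 12 sqrt gamma], and the offset at the start one more [sqrt gamma]. *)
rewrite e1 /K.
have := ler_wpM2l (mulr_ge0 (ltW N0R) (mulr_ge0 (ltW k0) g0)) e2.
lra.
Qed.

Lemma adversary_guarantee (R : realType) (theta gamma delta : R) (T N : nat)
    (X : Type) (x : 'I_N -> X) (y : 'I_N -> R)
    (sigma : history R N X -> 'I_N -> R) :
  0 < theta < 2 / 3 -> 0 <= gamma -> (8 <= T)%N -> (0 < N)%N ->
  0 <= delta < 1 -> gamma = delta ^+ 2 * T%:R / 2 ->
  injective x -> (forall i, y i = -1 \/ y i = 1) ->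
  T%:R `^ ((theta + 2) / 4) <= N%:R :> R -> player_strategy sigma ->
  exists2 alpha : history R N X -> ('I_N -> R) -> X -> R,
    adversary_strategy delta x y alpha &
    gauss_tail (Num.sqrt gamma) - gauss_coef R *
      (103 + 16 * Num.sqrt gamma) * T%:R `^ (- (theta / 4)) <=
    training_error x y (play sigma alpha T).
Proof.
move=> /andP[th0 th1] ga0 T8 N0 /andP[dl0 dl1] gaE xI y1 NT sigmaP.
have N0R : 0 < N%:R :> R by rewrite ltr0n.
have T0 : (0 < T)%N by apply: leq_trans T8.
have T1 : 1 <= T%:R :> R by rewrite ler1n.
have TN0 : (T%:R : R) != 0 by rewrite pnatr_eq0 -lt0n.
have k0 := gauss_coef_gt0 R; have g0 := sqrtr_ge0 gamma.
(* These choices balance the errors: [1 / sqrt tau] and [A / sqrt T] both equal [T ^ (- theta / 4)],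
   and [sqrt tau / A = T ^ (theta / 2 - 1 / 2)] is no larger because [theta < 2 / 3]. *)
pose tau : R := T%:R `^ (theta / 2); pose A : R := T%:R `^ (1 / 2 - theta / 4).
set rate := T%:R `^ (- (theta / 4)).
have tau1 : 1 <= tau by rewrite -(powRr0 T%:R) ler_powR//; lra.
have tauT : tau <= T%:R by apply: ler1_powR => //; lra.
(* The exponent of [A] exceeds [1 / 3], so [T >= 8] suffices. *)
have A2 : 2 <= A.
  have h8 : (8 : R) `^ 3^-1 = 2.
    have -> : (8 : R) = 2 `^ 3%:R by rewrite powR_mulrn//; ring.
    by rewrite -powRrM divff// powRr1.
  rewrite -h8; apply: (@le_trans _ _ (T%:R `^ 3^-1)).
    by apply: ge0_ler_powR; rewrite ?nnegrE// ler_nat.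
  by apply: ler_powR => //; lra.
have A0 : 0 < A by lra.
pose v (H : history R N X) : R := tau + T%:R - (size H).+1%:R.
have dl : 0 <= delta <= 1 by rewrite dl0 ltW.
have [alpha alphaP] := choice (fun Hp : history R N X * ('I_N -> R) =>
  adversary_reply A (v Hp.1) T Hp.2 Hp.1 dl xI y1).
exists (fun H p => alpha (H, p)); first by move=> H p; exact: (alphaP (H, p)).1.
set play_k := play sigma _.
pose f k := total_potential A (tau + T%:R - k%:R) delta T x y (play_k k).
(* [2 sqrt gamma] bounds [delta * sqrt v], and the summand [2] serves [sqrt v <= 2 * N], which
   follows from [v <= 2 T] and [sqrt T <= N]. *)
pose G := 2 * Num.sqrt gamma + 2.
pose K := (84 + 8 * G) * gauss_coef R.
have G0 : 0 <= G by rewrite /G; lra.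
have K0 : 0 <= K by rewrite mulr_ge0 ?(ltW k0)//; lra.
have sT : Num.sqrt T%:R <= N%:R :> R.
  by apply: le_trans NT; rewrite -powR12_sqrt//; apply: ler_powR => //; lra.
have fT : - f T <= - f 0%N + N%:R * K / Num.sqrt tau.
  apply: (@sqrt_gap_telescope _ _ (fun k => - f k)); first by rewrite mulr_ge0.
  move=> k kT; rewrite /f /play_k /= -/play_k.
  have kT' : k.+1%:R <= T%:R :> R by rewrite ler_nat.
  have kp : 1 <= k.+1%:R :> R by rewrite ler1n.
  have -> : tau + T%:R - k%:R = tau + T%:R - k.+1%:R + 1 :> R.
    by rewrite -natr1; ring.
  have vE : v (play_k k) = tau + T%:R - k.+1%:R by rewrite /v size_play.
  have v1 : 1 <= v (play_k k) by rewrite vE; lra.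
  have v2 : v (play_k k) <= 2 * T%:R by rewrite vE; lra.
  have := (alphaP (play_k k, sigma (play_k k))).2 G v1 A2; rewrite /= vE => step.
  have arith (r s t : R) : r - t <= s -> - s <= - r + t by move=> ?; lra.
  rewrite -(mulrA N%:R); apply/arith/step.
    rewrite -vE; apply: (@le_trans _ _ (2 * Num.sqrt gamma)); last by rewrite /G; lra.
    by apply: (@delta_sqrt_bound _ _ _ T) => //; apply/andP; split; lra.
  rewrite -vE; apply: (@le_trans _ _ (2 * N%:R)); last first.
    by rewrite ler_wpM2r// /G; lra.
  apply: (@le_trans _ _ (2 * Num.sqrt T%:R)); last by rewrite ler_wpM2l.
  rewrite -(@ler_pXn2r _ 2) ?nnegrE ?mulr_ge0 ?sqrtr_ge0//.
  by rewrite exprMn !sqr_sqrtr//; lra.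
have f0 : N%:R * (gauss_tail (Num.sqrt gamma) -
    gauss_coef R * (A / Num.sqrt T%:R)) <= f 0%N.
  rewrite /f subr0 total_potential_nil ler_pM2l//.
  have tau0 : 0 <= tau by lra.
  apply: le_trans (@gauss_tail_start_ge _ _ _ _ ga0 dl0 T0 gaE A tau (ltW A0) tau0) _.
  rewrite /chip_potential; case: ifPn => // _.
  by apply: gauss_tail_le1; rewrite divr_ge0 ?sqrtr_ge0// addr_ge0 ?mulr_ge0// ltW.
have err : f T <= N%:R * training_error x y (play_k T) +
    N%:R * (gauss_coef R * (2 * (Num.sqrt tau / A))).
  rewrite (training_errorE delta _ _ (size_play _ _ T)) mulVKf ?gt_eqF//.
  have -> c : N%:R * c = \sum_(i < N) c :> R.
    by rewrite sumr_const card_ord mulr_natl.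
  rewrite -big_split /=.
  apply: ler_sum => i _; rewrite addrK /chip_potential.
  have st : 0 < Num.sqrt tau by rewrite sqrtr_gt0; lra.
  case: ltP => [a0|_]; last by rewrite lerDl !mulr_ge0 ?invr_ge0 ?(ltW st) ?(ltW A0) ?(ltW k0).
  rewrite add0r; set a := _ + _ in a0 *.
  have r0 : 0 < Num.sqrt (2 * tau) by rewrite sqrtr_gt0; lra.
  apply: (@le_trans _ _ (gauss_tail (A / Num.sqrt (2 * tau)))).
    by apply: gauss_tail_antitone; rewrite ler_pM2r ?invr_gt0//; lra.
  apply: (le_trans (gauss_tail_le_inv _)); first by rewrite divr_gt0.
  rewrite ler_pM2l// invf_div mulrA ler_pM2r ?invr_gt0//.
  rewrite -(@ler_pXn2r _ 2) ?nnegrE ?mulr_ge0 ?sqrtr_ge0//.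
  by rewrite exprMn !sqr_sqrtr//; lra.
have e1 : (Num.sqrt tau)^-1 = rate.
  by rewrite sqrt_powR -powRN; congr (_ `^ _); field.
have e2 : A / Num.sqrt T%:R = rate.
  by rewrite -powR12_sqrt// -powRB ?TN0 ?implybT//; congr (_ `^ _); field.
have e3 : Num.sqrt tau / A <= rate.
  by rewrite sqrt_powR -powRB ?TN0 ?implybT//; apply: ler_powR => //; lra.
(* The rounds give [84 + 8 G = 100 + 16 sqrt gamma], the shift at the start [1] and the surviving
   chips [2]. *)
rewrite -(ler_pM2l N0R) mulrBr.
have := ler_wpM2l (ltW (mulr_gt0 N0R k0)) e3.
rewrite e2 mulrBr in f0; rewrite -mulrA e1 /K /G in fT.
lra.
Qed.

Theorem theorem2 (R : realType) (theta gamma : R)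
    (theta_gt0 : 0 < theta) (theta_lt : theta < 2 / 3) (gamma_ge0 : 0 <= gamma) :
  (exists (C : R) (T0 : nat), forall T : nat, (T0 <= T)%N ->
    forall (delta : R) (N : nat) (X : Type) (x : 'I_N -> X) (y : 'I_N -> R),
    0 <= delta < 1 -> gamma = delta ^+ 2 * T%:R / 2 ->
    (0 < N)%N -> injective x -> (forall i, y i = -1 \/ y i = 1) ->
    forall (sigma : history R N X -> 'I_N -> R)
           (alpha : history R N X -> ('I_N -> R) -> X -> R),
    player_strategy sigma -> adversary_strategy delta x y alpha ->
    (forall k, (k < T)%N ->
       obeys_boosting_rule delta theta T x y (play sigma alpha k)
                           (sigma (play sigma alpha k))) ->
    training_error x y (play sigma alpha T)
      <= gauss_tail (Num.sqrt gamma) + C * T%:R `^ (- (theta / 2)))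
  /\
  (exists (C : R) (T0 : nat), forall T : nat, (T0 <= T)%N ->
    forall (delta : R) (N : nat) (X : Type) (x : 'I_N -> X) (y : 'I_N -> R),
    0 <= delta < 1 -> gamma = delta ^+ 2 * T%:R / 2 ->
    (0 < N)%N -> injective x -> (forall i, y i = -1 \/ y i = 1) ->
    T%:R `^ ((theta + 2) / 4) <= N%:R :> R ->
    forall sigma : history R N X -> 'I_N -> R, player_strategy sigma ->
    exists2 alpha : history R N X -> ('I_N -> R) -> X -> R,
      adversary_strategy delta x y alpha &
      training_error x y (play sigma alpha T)
        >= gauss_tail (Num.sqrt gamma) - C * T%:R `^ (- (theta / 4))).
Proof.
have th : 0 < theta < 2 / 3 by rewrite theta_gt0.
split.
  exists (gauss_coef R * (84 + 13 * Num.sqrt gamma)), 1%N.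
  move=> T T0 delta N X x y dl gaE N0 _ y1 sigma alpha sP aP rule.
  exact: player_guarantee th gamma_ge0 T0 N0 dl gaE y1 sP aP rule.
exists (gauss_coef R * (103 + 16 * Num.sqrt gamma)), 8%N.
move=> T T8 delta N X x y dl gaE N0 xI y1 NT sigma sP.
exact: adversary_guarantee th gamma_ge0 T8 N0 dl gaE xI y1 NT sP.
Qed.
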